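(* Let $k \geq 2$ be a natural number and let $G$ be a connected graph that has a spanning $k$-end tree and satisfies $|V(G)| > k+1$. Then there exists an edge $e$ of $G$ such that $G/e$ has a spanning $k$-end tree.
   Context: All graphs are simple. $V(G)$ and $E(G)$ denote the vertex set and edge set of a graph $G$. A leaf of a tree is a vertex of degree one. A $k$-end tree is a tree with exactly $k$ leaves; a spanning $k$-end tree of $G$ is a spanning tree of $G$ that is a $k$-end tree. For an edge $e$ of $G$, the contraction $G/e$ is the simple graph obtained from $G$ by deleting $e$, identifying its two end vertices, and, whenever several parallel edges join the same two vertices, deleting all but one of them. *)

(* Defs.v *)
From mathcomp Require Import all_boot.

Set Implicit Arguments.
Unset Strict Implicit.
Unset Printing Implicit Defensive.

Record sgraph (V : finType) := SGraph {
  adj :> rel V;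
  adj_sym : symmetric adj;
  adj_irr : irreflexive adj
}.

Section Graphs.
Variable V : finType.
Implicit Types (G T : sgraph V) (e : {set V}).

Definition edges G : {set {set V}} :=
  [set [set p.1; p.2] | p : V * V & G p.1 p.2].

Definition degree G (x : V) : nat := #|[set y | G x y]|.

(* The graph without vertices is not considered connected. *)
Definition connected G : Prop := 0 < #|V| /\ forall x y : V, connect G x y.

(* A closed walk [:: x; y] is a [ucycle] but not a cycle of a graph. *)
Definition acyclic G : Prop := forall c : seq V, ucycle G c -> size c <= 2.

Definition is_tree G : Prop := connected G /\ acyclic G.

Definition leaves G : {set V} := [set x | degree G x == 1].

Definition kend_tree (k : nat) G : Prop := is_tree G /\ #|leaves G| = k.

Definition spanning_subgraph T G : Prop := edges T \subset edges G.

Definition has_spanning_kend_tree (k : nat) G : Prop :=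
  exists T : sgraph V, spanning_subgraph T G /\ kend_tree k T.

(* Vertices of G/e: [Some x] is a vertex x of G that is not an end of e, and
   [None] is the vertex obtained by identifying the two ends of e. *)
Definition contract_vertex e : finType := option {x : V | x \notin e}.

Definition contract_adj G e : rel (contract_vertex e) := fun a b =>
  match a, b with
  | Some x, Some y => G (val x) (val y)
  | Some x, None => [exists z in e, G (val x) z]
  | None, Some y => [exists z in e, G z (val y)]
  | None, None => false
  end.

Lemma contract_sym G e : symmetric (contract_adj G (e := e)).
Proof.
by case=> [x|] [y|] //=; first exact: adj_sym;
   apply: eq_existsb => z; rewrite adj_sym.
Qed.

Lemma contract_irr G e : irreflexive (contract_adj G (e := e)).
Proof. by case=> [x|] //=; exact: adj_irr. Qed.

Definition contract G e : sgraph (contract_vertex e) :=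
  SGraph (contract_sym G (e := e)) (contract_irr G (e := e)).

End Graphs.

(* Main.v *)
Require Import Defs.
From mathcomp Require Import all_boot.

(* A vertex next to an end of a path between two non-leaves is again a
   non-leaf, so as soon as a tree has two non-leaves it has an edge uv joining
   two of them. Contracting uv keeps all other degrees, because a tree has no
   triangle, and the merged vertex has degree d(u) + d(v) - 2 >= 2; hence the
   contracted tree has as many leaves as the original one. *)

Set Implicit Arguments.
Unset Strict Implicit.
Unset Printing Implicit Defensive.

Section SimpleGraphs.
Variable V : finType.
Implicit Types G T : sgraph V.

Lemma in_edges G x y : ([set x; y] \in edges G) = G x y.
Proof.
apply/imsetP/idP => [[[a b]] /[!inE] /= Gab xyE|Gxy]; last by exists (x, y); rewrite ?inE.
have: a \in [set x; y] by rewrite xyE set21.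
have: b \in [set x; y] by rewrite xyE set22.
have: x \in [set a; b] by rewrite -xyE set21.
have: y \in [set a; b] by rewrite -xyE set22.
rewrite !inE => /orP[]/eqP ya /orP[]/eqP xa /orP[]/eqP bx /orP[]/eqP ax;
  by subst; rewrite ?Gab // adj_sym.
Qed.

Lemma spanning_subgraphP T G :
  spanning_subgraph T G <-> (forall x y, T x y -> G x y).
Proof.
split=> [/subsetP sTG x y Txy|sTG].
  by rewrite -in_edges; apply: sTG; rewrite in_edges.
apply/subsetP=> _ /imsetP[[x y] /[!inE] Txy ->] /=.
by rewrite in_edges; apply: sTG.
Qed.

(** The given neighbour [y] excludes degree 0, so failing to be a leaf amounts to having a second
    neighbour. *)
Lemma leavesPn G x y : G x y ->
  reflect (exists2 z, G x z & z != y) (x \notin leaves G).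
Proof.
move=> Gxy; rewrite inE /degree (cardsD1 y) inE Gxy add1n eqSS cards_eq0.
apply: (iffP (set0Pn _)) => [[z]|[z Gxz zy]].
  by rewrite !inE => /andP[zy Gxz]; exists z.
by exists z; rewrite !inE zy.
Qed.

Lemma acyclic_triangle_free G x y z :
  acyclic G -> G x y -> G y z -> G x z -> False.
Proof.
move=> acG Gxy Gyz Gxz.
have neq a b : G a b -> a != b by apply: contraTneq => ->; rewrite adj_irr.
have := acG [:: x; y; z]; rewrite /ucycle /= !inE => /(_ _)/implyP.
by rewrite Gxy Gyz (adj_sym G z) Gxz negb_or !neq //= => /(_ isT).
Qed.

(** Take a simple path between two non-leaves. If it is a single edge, that edge works; otherwise
    its second vertex has two distinct neighbours on the path, so the first edge works. *)
Lemma edge_between_nonleaves G : connected G -> 1 < #|~: leaves G| ->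
  exists u v, [/\ G u v, u \notin leaves G & v \notin leaves G].
Proof.
move=> [_ Gconn] /card_gt1P[u [w [uL wL uw]]].
rewrite !in_setC in uL wL.
have /connectP[p0 p0P wE] := Gconn u w.
case/shortenP: p0P wE => -[|v [|z p]] /=.
- by move=> _ _ _ uE; rewrite uE eqxx in uw.
- by rewrite andbT => Guv _ _ wE; subst w; exists u, v.
case/and3P=> Guv Gvz _; rewrite !inE !negb_or => /and3P[/and3P[_ uz _] _ _] _ _.
exists u, v; split=> //; apply/(@leavesPn _ _ u); first by rewrite adj_sym.
by exists z; rewrite 1?eq_sym.
Qed.

End SimpleGraphs.

Section Contraction.
Variables (V : finType) (e : {set V}).
Implicit Types G T : sgraph V.

(** The quotient map of the contraction: [insub] yields [None] exactly on [e]. *)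
Definition contract_proj (x : V) : contract_vertex e := insub x.

Lemma contract_proj_in x : x \in e -> contract_proj x = None.
Proof. by move=> xe; rewrite /contract_proj insubF // xe. Qed.

Lemma contract_projK (a : {x | x \notin e}) : contract_proj (val a) = Some a.
Proof. exact: valK. Qed.

Lemma contract_projP G x y : G x y ->
  contract_proj x = contract_proj y
  \/ contract G e (contract_proj x) (contract_proj y).
Proof.
rewrite /contract_proj => Gxy.
case: (insubP _ x) => [a _ aE|]; case: (insubP _ y) => [b _ bE|] /=.
- by rewrite aE bE; right.
- by rewrite negbK => ye; right; rewrite aE; apply/existsP; exists y; rewrite ye.
- by rewrite bE negbK => xe; right; apply/existsP; exists x; rewrite xe.
- by left.
Qed.

Lemma contract_subgraph T G :
  spanning_subgraph T G -> spanning_subgraph (contract T e) (contract G e).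
Proof.
move=> /spanning_subgraphP sTG; apply/spanning_subgraphP=> -[x|] [y|] //=.
- exact: sTG.
- by case/existsP=> z /andP[ze Txz]; apply/existsP; exists z; rewrite ze sTG.
- by case/existsP=> z /andP[ze Txz]; apply/existsP; exists z; rewrite ze sTG.
Qed.

(** Walks of [G] project to walks, some steps collapsing. Nonemptiness of [e] puts [None] in the
    image of the projection. *)
Lemma contract_connected G : connected G -> e != set0 -> connected (contract G e).
Proof.
move=> [_ Gconn] /set0Pn[z ze]; split; first by apply/card_gt0P; exists None.
have surj a : exists x, contract_proj x = a.
  by case: a => [a|]; [exists (val a); exact: contract_projK
                      | exists z; exact: contract_proj_in].
move=> a b; have [x <-] := surj a; have [y <-] := surj b.
have /connectP[p pP ->] := Gconn x y.
elim: p x pP => [|w p IHp] x /=; first by rewrite connect0.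
case/andP=> /contract_projP Gxw /IHp; apply: connect_trans.
by case: Gxw => [->|]; [exact: connect0 | exact: connect1].
Qed.

Lemma lift_seq (c : seq (contract_vertex e)) :
  None \notin c -> exists s, c = map Some s.
Proof.
elim: c => [|[a|] c IHc]; first by exists [::].
  by rewrite inE /= => /IHc[s ->]; exists (a :: s).
by rewrite inE eqxx.
Qed.

End Contraction.

Section EdgeContraction.
Variables (V : finType) (G : sgraph V) (u v : V).
Hypotheses (Guv : G u v) (acG : acyclic G).

Let e := [set u; v].

(** A cycle avoiding [None] is already one of [G]. A cycle through [None] leaves it from an end [z]
    of [e] and returns to an end [w]: replace [None] by [z] if they agree, and by the edge [w z]
    otherwise. *)
Lemma contract_edge_acyclic : acyclic (contract G e).
Proof.
have lift_path a s : path (contract G e) (Some a) (map Some s)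
    = path G (val a) (map val s).
  by elim: s a => //= b s IHs a; rewrite IHs.
have uniq_lift (s : seq {x | x \notin e}) : uniq (map val s) = uniq s.
  by rewrite (map_inj_uniq val_inj).
have notin_lift z (s : seq {x | x \notin e}) : z \in e -> z \notin map val s.
  by move=> ze; apply/mapP=> -[a _ zE]; rewrite zE (negPf (valP a)) in ze.
move=> c; have [Nc|/lift_seq[[|a s] ->]] := boolP (None \in c); last 2 first.
- by [].
- rewrite /ucycle (map_inj_uniq (@Some_inj _)) -uniq_lift size_map => /andP[].
  rewrite /= -map_rcons lift_path map_rcons => cyc uq.
  by have := acG (c := map val (a :: s)); rewrite size_map /ucycle /= cyc; exact.
case/rot_to: Nc => i c' cE.
rewrite -(rot_ucycle i) -(size_rot i c) cE => /andP[cyc /andP[/lift_seq[s c'E]]].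
rewrite {c'}c'E in cyc cE *.
rewrite -/(uniq _) (map_inj_uniq (@Some_inj _)) -uniq_lift => uq.
case: s => [|a s] // in cyc uq cE *.
move: cyc; rewrite /= rcons_path lift_path => /and3P[/existsP[z /andP[ze Gza]] pP].
rewrite last_map /= => /existsP[w /andP[we Gbw]].
(* The closing vertex [t] is left free: it will be [z] in the first case below and [w] in the
   second. *)
have {pP} pP t : path G (val a) (rcons (map val s) t)
    = G (val (last a s)) t by rewrite rcons_path pP last_map.
have [zw|zw] := eqVneq z w.
  suff /acG : ucycle G (z :: map val (a :: s)).
    by rewrite /= !size_map.
  by rewrite /ucycle cons_uniq uq notin_lift //= Gza pP zw Gbw.
have Gwz : G w z.
  move: ze we zw; rewrite !inE => /orP[]/eqP-> /orP[]/eqP->; rewrite ?eqxx //.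
  by rewrite adj_sym.
(* This cycle has at least three vertices, so it contradicts acyclicity outright. *)
suff /acG : ucycle G (w :: z :: map val (a :: s)) by rewrite /= size_map.
rewrite /ucycle 2!cons_uniq uq inE negb_or eq_sym zw !notin_lift //.
by rewrite /= Gwz Gza pP Gbw.
Qed.

(** Only [u] and [v] get identified, and a common neighbour of both would close a triangle. *)
Lemma contract_proj_inj_nbr x : x \notin e ->
  {in [set y | G x y] &, injective (@contract_proj _ e)}.
Proof.
move=> xe y z; rewrite !inE /contract_proj => Gxy Gxz.
case: (insubP _ y) => [a _ <-|]; case: (insubP _ z) => [b _ <-|] //; first by case=> ->.
rewrite !negbK !inE => /orP[]/eqP zE /orP[]/eqP yE _; subst=> //.
- by case: (acyclic_triangle_free acG Gxz Guv Gxy).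
- by case: (acyclic_triangle_free acG Gxy Guv Gxz).
Qed.

Lemma degree_contract_edge (a : {x | x \notin e}) :
  degree (contract G e) (Some a) = degree G (val a).
Proof.
rewrite /degree -(card_in_imset (contract_proj_inj_nbr (valP a))).
apply: eq_card => b; rewrite inE; apply/idP/imsetP => [|[y]].
  case: b => [b|] /= Gab; first by exists (val b); rewrite ?inE ?contract_projK.
  by case/existsP: Gab => z /andP[ze Gaz]; exists z; rewrite ?inE ?contract_proj_in.
rewrite inE => Gay bE; have := contract_projP e Gay.
(* The edge cannot collapse: only [val a] projects to [Some a], and [G] has no loops. *)
rewrite contract_projK -bE => -[aE|//]; move: aE Gay; rewrite bE /contract_proj.
by case: insubP => // c _ <- [->]; rewrite adj_irr.
Qed.

Hypotheses (uL : u \notin leaves G) (vL : v \notin leaves G).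

(** Each end of [e] has a neighbour outside [e]; the two are distinct since there is no triangle, so
    [None] keeps two neighbours. *)
Lemma contracted_vertex_nonleaf : None \notin leaves (contract G e).
Proof.
have Gvu : G v u by rewrite adj_sym.
have [a Gua av] := leavesPn Guv uL.
have [b Gvb bu] := leavesPn Gvu vL.
have neq x y : G x y -> y != x by apply: contraTneq => ->; rewrite adj_irr.
have ae : a \notin e by rewrite !inE negb_or av neq.
have be : b \notin e by rewrite !inE negb_or bu neq.
have ab : a != b.
  apply: contraTneq Gua => ->; apply/negP=> Gub.
  exact: acyclic_triangle_free acG Guv Gvb Gub.
apply/(@leavesPn _ _ _ (Some (Sub b be))).
  by apply/existsP; exists v; rewrite set22.
exists (Some (Sub a ae)) => //.
by apply/existsP; exists u; rewrite set21.
Qed.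

Lemma card_leaves_contract_edge : #|leaves (contract G e)| = #|leaves G|.
Proof.
(* Both leaf sets are injective images of [L], as neither [None] nor an end of [e] is a leaf. *)
pose L : {set {x | x \notin e}} := [set a | val a \in leaves G].
have -> : leaves (contract G e) = Some @: L.
  apply/setP=> -[a|]; last first.
    by rewrite (negPf contracted_vertex_nonleaf); apply/esym/imsetP=> -[].
  by rewrite mem_imset ?inE ?degree_contract_edge //; exact: Some_inj.
have -> : leaves G = val @: L.
  apply/setP=> x; apply/idP/imsetP => [xL|[a /[!inE] aL ->] //].
  have xe : x \notin e.
    by rewrite !inE; apply/norP; split; apply: contraTneq xL => ->.
  by exists (Sub x xe); rewrite // inE.
rewrite !card_imset //; [exact: val_inj | exact: Some_inj].
Qed.

End EdgeContraction.

Lemma contract_edge_kend_tree (V : finType) (T : sgraph V) (k : nat) (u v : V) :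
  kend_tree k T -> T u v -> u \notin leaves T -> v \notin leaves T ->
  kend_tree k (contract T [set u; v]).
Proof.
move=> [[Tconn acT] Tk] Tuv uL vL; split; last by rewrite card_leaves_contract_edge.
split; last exact: contract_edge_acyclic.
by apply: contract_connected => //; apply/set0Pn; exists u; rewrite set21.
Qed.

Theorem theorem2p1 (k : nat) (hk : 2 <= k) (V : finType) (G : sgraph V)
    (Gconn : connected G) (GT : has_spanning_kend_tree k G)
    (hV : k + 1 < #|V|) :
  exists e : {set V}, e \in edges G /\ has_spanning_kend_tree k (contract G e).
Proof.
case: GT => T [sTG kT]; have [[Tconn _] Tk] := kT.
have [|u [v [Tuv uL vL]]] := edge_between_nonleaves Tconn.
  (* There are [#|V| - k] non-leaves, so the bound on [#|V|] says that there are at least two. *)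
  by rewrite cardsCs setCK Tk ltn_subRL.
exists [set u; v]; split; first by apply: (subsetP sTG); rewrite in_edges.
exists (contract T [set u; v]); split; first exact: contract_subgraph.
exact: contract_edge_kend_tree.
Qed.
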